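(* Let $P$ be the uniform distribution on the boundary of the regular hexagon with vertices $(0,0)$, $(1,0)$, $(\frac32,\frac{\sqrt3}{2})$, $(1,\sqrt3)$, $(0,\sqrt3)$, $(-\frac12,\frac{\sqrt3}{2})$. Then the quantization dimension $D(P)$ exists and equals the dimension of the boundary of the hexagon, i.e. $D(P)=1$. Moreover, the (one-dimensional) quantization coefficient exists as a finite positive number, which equals $3$, i.e. $\lim_{n\to\infty}n^2V_n(P)=3$.
   Context: For a Borel probability measure $P$ on $\mathbb{R}^2$ with finite second moment, the $n$th quantization error is $V_n(P)=\inf\{\int\min_{a\in\alpha}\|x-a\|^2\,dP(x):\alpha\subset\mathbb{R}^2,\ \mathrm{card}(\alpha)\le n\}$. The quantization dimension of $P$ is $D(P)=\lim_{n\to\infty}\frac{2\log n}{-\log V_n(P)}$, if the limit exists. For $s\in(0,\infty)$ the $s$-dimensional quantization coefficient is $\lim_{n\to\infty}n^{2/s}V_n(P)$, if it exists; here $s=1$. The uniform distribution on the hexagon boundary is normalized arc length, $dP=\frac16\,ds$. *)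

(* Defs.v *)
From HB Require Import structures.
From mathcomp Require Import all_boot all_order all_algebra.
From mathcomp Require Import finmap.
From mathcomp Require Import all_classical all_reals all_analysis.
From mathcomp Require Import measurable_realfun ring lra.
Set Implicit Arguments.
Unset Strict Implicit.
Unset Printing Implicit Defensive.
Import Order.TTheory GRing.Theory Num.Theory.
Import numFieldNormedType.Exports.
Local Open Scope classical_set_scope.
Local Open Scope ring_scope.

(* The library norm on [R * R] is the sup norm, hence an explicit Euclidean
   distance; the product sigma-algebra on [R * R] is the Borel one. *)
Definition edist (R : realType) (x y : R * R) : R :=
  Num.sqrt ((x.1 - y.1) ^+ 2 + (x.2 - y.2) ^+ 2).

Section quantization.
Context (R : realType).
Local Open Scope ereal_scope.

(* [min_(a in alpha) |x - a|^2]; it is [+oo] for the empty set, which therefore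
   never contributes to the infimum in [quantization_error]. *)
Definition distortion (alpha : {fset R * R}) (x : R * R) : \bar R :=
  \big[mine/+oo]_(a <- alpha) ((edist x a) ^+ 2)%:E.

Definition quantization_error (P : probability (R * R)%type R) (n : nat)
    : \bar R :=
  ereal_inf [set \int[P]_x distortion alpha x
            | alpha in [set alpha : {fset R * R} | (#|` alpha| <= n)%N]].

(* [fine] is harmless: the error is finite for [n >= 1] as soon as [P] has a
   finite second moment. *)
Definition has_quantization_dimension (P : probability (R * R)%type R) (D : R)
    : Prop :=
  ((2 * ln n%:R / - ln (fine (quantization_error P n)))%R @[n --> \oo] --> D)%R.

Definition has_quantization_coefficient (s : R)
    (P : probability (R * R)%type R) (c : R) : Prop :=
  (n%:R `^ (2 / s))%:E * quantization_error P n @[n --> \oo] --> c%:E.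

End quantization.

Section segment_arc_length.
Context (R : realType).
Implicit Types u v : R * R.

Definition segment u v (t : R) : R * R :=
  ((1 - t) * u.1 + t * v.1, (1 - t) * u.2 + t * v.2).

Lemma measurable_segment u v : measurable_fun setT (segment u v).
Proof.
apply: measurable_fun_pair => /=; apply: measurable_funD;
  apply: measurable_funM => //; exact: measurable_funB.
Qed.

Definition unit_interval_measure : set (measurableTypeR R) -> \bar R :=
  mrestr lebesgue_measure (measurable_itv (`[0, 1] : interval R)).

HB.instance Definition _ := Measure.on unit_interval_measure.

Definition segment_pushforward u v : set (R * R) -> \bar R :=
  pushforward unit_interval_measure (segment u v).

Section instances.
Variables u v : R * R.

Let segment_pushforward0 : segment_pushforward u v set0 = 0%E.
Proof. by rewrite /segment_pushforward /pushforward preimage_set0 measure0. Qed.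

Let segment_pushforward_ge0 A : (0 <= segment_pushforward u v A)%E.
Proof. exact: (measure_ge0 unit_interval_measure). Qed.

Let segment_pushforward_sigma_additive :
  semi_sigma_additive (segment_pushforward u v).
Proof.
by apply: measure_semi_sigma_additive; exact: measurable_segment.
Qed.

HB.instance Definition _ := isMeasure.Build _ _ _ (segment_pushforward u v)
  segment_pushforward0 segment_pushforward_ge0
  segment_pushforward_sigma_additive.
End instances.

Lemma edist_ge0 u v : 0 <= edist u v.
Proof. exact: sqrtr_ge0. Qed.

(* Arc length on the segment from [u] to [v]: the parametrization [segment u v]
   has constant speed [edist u v]. *)
Definition segment_arc_length u v : set (R * R) -> \bar R :=
  mscale (NngNum (edist_ge0 u v)) (segment_pushforward u v).

HB.instance Definition _ u v := Measure.on (segment_arc_length u v).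

End segment_arc_length.

Section hexagon.
Context (R : realType).

Definition hexagon_vertices : seq (R * R) :=
  [:: (0, 0); (1, 0); (3 / 2, Num.sqrt 3 / 2);
      (1, Num.sqrt 3); (0, Num.sqrt 3); (- (1 / 2), Num.sqrt 3 / 2)].

Definition hexagon_vertex (k : nat) : R * R := hexagon_vertices`_(k %% 6).

Definition hexagon_arc_length : set (R * R) -> \bar R :=
  msum (fun k => segment_arc_length (hexagon_vertex k) (hexagon_vertex k.+1)) 6.

HB.instance Definition _ := Measure.on hexagon_arc_length.

Definition hexagon_uniform : set (R * R) -> \bar R :=
  mscale (6^-1)%:nng hexagon_arc_length.

HB.instance Definition _ := Measure.on hexagon_uniform.

Lemma segment_arc_lengthT (u v : R * R) :
  segment_arc_length u v setT = (edist u v)%:E.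
Proof.
rewrite /segment_arc_length /mscale /= /segment_pushforward /pushforward.
rewrite preimage_setT /unit_interval_measure /mrestr setTI.
by rewrite lebesgue_measure_itv /= lte_fin ltr01 oppr0 adde0 mule1.
Qed.

Lemma hexagon_side (k : nat) : (k < 6)%N ->
  edist (hexagon_vertex k) (hexagon_vertex k.+1) = 1.
Proof.
have s3 : Num.sqrt (3 : R) ^+ 2 = 3 by rewrite sqr_sqrtr.
rewrite /edist -[RHS]sqrtr1.
by do 6?[case: k => [_|k]] => //; congr Num.sqrt;
  rewrite /hexagon_vertex /=; field: s3.
Qed.

Lemma hexagon_uniformT : hexagon_uniform setT = 1%E.
Proof.
rewrite /hexagon_uniform /mscale /= /hexagon_arc_length /msum.
rewrite (eq_bigr (fun=> 1%:E)); last first.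
  move=> k _; rewrite -(hexagon_side (ltn_ord k)).
  exact: segment_arc_lengthT.
rewrite sumEFin sumr_const card_ord -EFinM; congr EFin.
by rewrite mulVf.
Qed.

HB.instance Definition _ :=
  Measure_isProbability.Build _ _ _ hexagon_uniform hexagon_uniformT.

End hexagon.

(* Main.v *)
(* Lower bound: for a finite set alpha of at most n points and any r > 0, the
   distortion f satisfies f + sum_(a in alpha) max(0, r^2 - |x - a|^2) >= r^2.
   Along a side, a bump max(0, r^2 - |x - a|^2) is dominated by the bump about
   the foot of the perpendicular from a, whose integral is 4 r^3 / 3; once the
   sides are trimmed by 4 r at both ends, each a acts on at most one side.
   Hence 6 V_n >= 6 r^2 (1 - 8 r) - 4 n r^3 / 3, and r = 3 / n gives
   n^2 V_n >= 3 - O(1/n).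
   Upper bound: the midpoints of a subdivision of each side into
   m = floor(n / 6) equal pieces give V_n <= 1 / (12 m^2). *)
Require Import Defs.
From mathcomp Require Import all_boot all_order all_algebra.
From mathcomp Require Import finmap.
From mathcomp Require Import all_classical all_reals all_analysis.
From mathcomp Require Import measurable_realfun ring lra.
Import Defs.
Set Implicit Arguments.
Unset Strict Implicit.
Unset Printing Implicit Defensive.
Import Order.TTheory GRing.Theory Num.Theory.
Import numFieldNormedType.Exports.
Local Open Scope classical_set_scope.
Local Open Scope ring_scope.

(** * Integration against the uniform measure on the hexagon *)

Lemma ge0_integral_mrestr d (T : measurableType d) (R : realType)
    (mu : {measure set T -> \bar R}) (D : set T) (mD : measurable D)
    (f : T -> \bar R) :
  measurable_fun setT f -> (forall x, (0 <= f x)%E) ->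
  (\int[mrestr mu mD]_x f x = \int[mu]_(x in D) f x)%E.
Proof.
move=> mf f0; rewrite -(setUv D) ge0_integral_setU//=; last 3 first.
- exact: measurableC.
- exact: measurable_funTS.
- by rewrite disj_set2E setICr.
rewrite [X in (_ + X)%E]null_set_integral ?adde0.
- apply: eq_measure_integral => A _ AD.
  by rewrite /= /mrestr (setIidl AD).
- exact: measurableC.
- exact: measurable_funTS.
- by rewrite /= /mrestr setICl measure0.
Qed.

Lemma ge0_integral_segment_arc_length (R : realType) (u v : R * R)
    (f : R * R -> \bar R) :
  measurable_fun setT f -> (forall x, (0 <= f x)%E) ->
  (\int[segment_arc_length u v]_x f x =
   (edist u v)%:E *
   \int[lebesgue_measure]_(t in `[0%R, 1%R]) f (segment u v t))%E.
Proof.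
move=> mf f0; rewrite /segment_arc_length ge0_integral_mscale//=.
congr (_ * _)%E.
rewrite /segment_pushforward ge0_integral_pushforward//=;
  last exact: measurable_segment.
rewrite preimage_setT /unit_interval_measure ge0_integral_mrestr//.
exact: (measurableT_comp mf (measurable_segment u v)).
Qed.

Lemma ge0_integral_hexagon_uniform (R : realType) (f : R * R -> \bar R) :
  measurable_fun setT f -> (forall x, (0 <= f x)%E) ->
  (\int[@hexagon_uniform R]_x f x = (6^-1)%:E * \sum_(k < 6)
    \int[lebesgue_measure]_(t in `[0%R, 1%R])
      f (segment (hexagon_vertex R k) (hexagon_vertex R k.+1) t))%E.
Proof.
move=> mf f0; rewrite /hexagon_uniform ge0_integral_mscale//=; congr (_ * _)%E.
rewrite /hexagon_arc_length ge0_integral_measure_sum//.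
apply: eq_bigr => k _; rewrite ge0_integral_segment_arc_length//.
by rewrite hexagon_side ?mul1e.
Qed.

(** Serves both bounds: [A = r ^+ 2], [B = -1] gives the mass 4 r^3 / 3 of a bump; [A = 0], [B = 1]
    gives the second moment 2 r^3 / 3 of an interval about its midpoint. *)
Lemma integral_square (R : realType) (c r A B : R) : 0 < r ->
  (\int[lebesgue_measure]_(t in `[(c - r)%R, (c + r)%R])
     (A + B * (t - c) ^+ 2)%:E = (2 * A * r + 2 / 3 * B * r ^+ 3)%:E)%E.
Proof.
move=> r0.
pose f (t : R) := A + B * (t - c) ^+ 2.
have cf : continuous f.
  move=> t; apply/differentiable_continuous/derivable1_diffP.
  by rewrite /f; exact: ex_derive.
pose F (t : R) := A * t + B / 3 * (t - c) ^+ 3.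
have dF (t : R) : is_derive t 1 F (A + B * (t - c) ^+ 2).
  rewrite /F; apply: is_derive_eq.
  by rewrite /GRing.scale/=; field.
have cF : continuous F.
  move=> t; apply/differentiable_continuous/derivable1_diffP.
  exact: ex_derive.
rewrite (@continuous_FTC2 _ f F).
- by rewrite -EFinB; congr EFin; rewrite /F; field.
- lra.
- exact: continuous_subspaceT.
- split => [t _||]; first exact: ex_derive.
  + by apply: cvg_at_right_filter; exact: cF.
  + by apply: cvg_at_left_filter; exact: cF.
- by move=> t _; rewrite derive1E; exact: derive_val.
Qed.

(** * Euclidean distance and distortion *)

Lemma edist_sqr (R : realType) (x a : R * R) :
  (edist x a) ^+ 2 = (x.1 - a.1) ^+ 2 + (x.2 - a.2) ^+ 2.
Proof. by rewrite /edist sqr_sqrtr// addr_ge0 ?sqr_ge0. Qed.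

Lemma measurable_distortion (R : realType) (alpha : {fset R * R}) :
  measurable_fun setT (distortion alpha).
Proof.
rewrite /distortion; elim: (enum_fset alpha) => [|a s ih].
  by under eq_fun do rewrite big_nil; exact: measurable_cst.
under eq_fun do rewrite big_cons; apply: measurable_mine => //.
apply/measurable_EFinP; under eq_fun do rewrite edist_sqr.
by apply: measurable_funD; apply: measurable_funX; apply: measurable_funB.
Qed.

Lemma distortion_ge0 (R : realType) (alpha : {fset R * R}) x :
  (0 <= distortion alpha x)%E.
Proof.
rewrite /distortion; elim: (enum_fset alpha) => [|a s ih].
  by rewrite big_nil.
by rewrite big_cons le_min ih lee_fin sqr_ge0.
Qed.

Lemma distortion_le (R : realType) (alpha : {fset R * R}) a x :
  a \in alpha -> (distortion alpha x <= ((edist x a) ^+ 2)%:E)%E.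
Proof. by move=> aA; rewrite /distortion (big_rem a)//= ge_min lexx. Qed.

(** The minimum is attained at some index, whose own [G] lifts it to [y]; the other [G] only add.
    For empty [s] the minimum is [+oo]. *)
Lemma le_bigmine_sum (R : realDomainType) (I : Type) (s : seq I)
    (F G : I -> \bar R) (y : \bar R) :
  (forall i, (y <= F i + G i)%E) -> (forall i, (0 <= G i)%E) ->
  (y <= \big[mine/+oo]_(i <- s) F i + \sum_(i <- s) G i)%E.
Proof.
move=> yFG G0; elim: s => [|a s ih]; first by rewrite !big_nil adde0 leey.
rewrite !big_cons; have S0 : (0 <= \sum_(i <- s) G i)%E by exact: sume_ge0.
case: (leP (F a)) => _.
  by apply: le_trans (yFG a) _; rewrite leeD2l// leeDl.
by apply: le_trans ih _; rewrite leeD2l// leeDr.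
Qed.

(** * Parabolic bumps on the line *)

Section parabolic_bump.
Context (R : realType).
Implicit Types r c t : R.

(** For [r >= 0] this is max(0, r^2 - (t - c)^2); as a restriction, its integral over the line
    becomes one over an interval. *)
Definition bump r c : R -> \bar R :=
  (fun t => (r ^+ 2 - (t - c) ^+ 2)%:E) \_ `[c - r, c + r].

Lemma bump_in r c t : `|t - c| <= r -> bump r c t = (r ^+ 2 - (t - c) ^+ 2)%:E.
Proof.
by move=> tc; rewrite /bump patchT// inE/= in_itv/= -ler_distlC distrC.
Qed.

Lemma bump_ge0 r c t : (0 <= bump r c t)%E.
Proof.
rewrite /bump /patch; case: ifPn => // /[!inE]/=.
rewrite in_itv/= => /andP[tl tr]; rewrite lee_fin.
have -> : r ^+ 2 - (t - c) ^+ 2 = (c + r - t) * (t - (c - r)) by ring.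
by apply: mulr_ge0; rewrite subr_ge0.
Qed.

Lemma measurable_bump r c : measurable_fun setT (bump r c).
Proof.
apply/(measurable_restrictT _ _).1; first exact: measurable_itv.
apply/measurable_EFinP/measurable_funTS.
by apply: measurable_funB => //; apply: measurable_funX; apply: measurable_funB.
Qed.

Lemma integral_bump_le r c (D : set R) : 0 < r -> measurable D ->
  (\int[lebesgue_measure]_(t in D) bump r c t <= (4 / 3 * r ^+ 3)%:E)%E.
Proof.
move=> r0 mD.
apply: (@le_trans _ _ (\int[lebesgue_measure]_t bump r c t)%E).
  apply: ge0_subset_integral => //; first exact: measurable_bump.
  by move=> t _; exact: bump_ge0.
rewrite -integral_mkcond.
have -> : 4 / 3 * r ^+ 3 = 2 * r ^+ 2 * r + 2 / 3 * -1 * r ^+ 3 by field.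
rewrite -(integral_square c)//.
by under eq_integral do rewrite -mulN1r.
Qed.

End parabolic_bump.

(** * Distances to points of a segment *)

Section segment_distance.
Context (R : realType).
Implicit Types u v a : R * R.

(** When [edist u v = 1], the parameter of the orthogonal projection of [a] onto the line through
    [u] and [v]. *)
Definition foot u v a : R :=
  (a.1 - u.1) * (v.1 - u.1) + (a.2 - u.2) * (v.2 - u.2).

(* By Lagrange's identity the difference is the square of a cross product. *)
Lemma edist_sqr_foot u v a (t : R) : edist u v = 1 ->
  (t - foot u v a) ^+ 2 <= (edist (segment u v t) a) ^+ 2.
Proof.
move=> uv; have := edist_sqr u v; rewrite uv expr1n => uv1.
rewrite edist_sqr /foot /segment/= -subr_ge0.
set d := v.1 - u.1; set e := v.2 - u.2.
set x := a.1 - u.1; set y := a.2 - u.2.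
have de1 : d ^+ 2 + e ^+ 2 = 1 by rewrite uv1 /d /e; ring.
rewrite [X in 0 <= X](_ : _ =
    (t ^+ 2 - x ^+ 2 - y ^+ 2) * (d ^+ 2 + e ^+ 2 - 1) + (x * e - y * d) ^+ 2).
  by rewrite de1 subrr mulr0 add0r sqr_ge0.
by rewrite /d /e /x /y; ring.
Qed.

Lemma edist_sqr_segment u v (s t : R) :
  (edist (segment u v s) (segment u v t)) ^+ 2 =
  (s - t) ^+ 2 * (edist u v) ^+ 2.
Proof. by rewrite !edist_sqr /segment/=; ring. Qed.

Lemma measurable_distortion_segment u v (alpha : {fset R * R}) :
  measurable_fun setT (fun t => distortion alpha (segment u v t)).
Proof.
apply: (measurableT_comp (measurable_distortion alpha)).
exact: measurable_segment.
Qed.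

End segment_distance.

(** * Sides of the hexagon and their separation *)

Section sides.
Context (R : realType).

Definition side (k : nat) : R -> R * R :=
  segment (hexagon_vertex R k) (hexagon_vertex R k.+1).

Lemma integral_hexagon_distortion (alpha : {fset R * R}) :
  (\int[@hexagon_uniform R]_x distortion alpha x = (6^-1)%:E * \sum_(k < 6)
     \int[lebesgue_measure]_(t in `[0%R, 1%R]) distortion alpha (side k t))%E.
Proof.
apply: ge0_integral_hexagon_uniform; first exact: measurable_distortion.
exact: distortion_ge0.
Qed.

(* Trimming by [4 * r] keeps distinct sides more than [2 * r] apart, whereas an
   untrimmed corner would let a single ball serve two sides. *)
Definition meets_trimmed_side (r : R) (a : R * R) (k : nat) : bool :=
  `[< exists2 t, 4 * r <= t <= 1 - 4 * r & edist (side k t) a < r >].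

(* In units of [Num.sqrt 3], so that all coordinates are rational and linear
   arithmetic applies. *)
Definition side_ordinate (k : nat) : R :=
  [:: 0; 0; 1 / 2; 1; 1; 1 / 2]`_(k %% 6).

Lemma hexagon_vertex2 k : (k < 7)%N ->
  (hexagon_vertex R k).2 = Num.sqrt 3 * side_ordinate k.
Proof.
by do 7?[case: k => [_|k]] => //;
  rewrite /hexagon_vertex /side_ordinate /=; lra.
Qed.

(** Trades a disc for linear constraints: with X and Y the two offsets in the conclusion, the
    squared distance is X^2 + 3 Y^2, so both |X| and |Y| are below [r]. *)
Lemma side_coordinates_lt r a k t : (k < 6)%N -> edist (side k t) a < r ->
  - r < (1 - t) * (hexagon_vertex R k).1 + t * (hexagon_vertex R k.+1).1 - a.1
    < r /\
  - r < (1 - t) * side_ordinate k + t * side_ordinate k.+1 - a.2 / Num.sqrt 3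
    < r.
Proof.
move=> k6 lt_r; have r0 : 0 < r by apply: le_lt_trans (edist_ge0 _ _) lt_r.
have : (edist (side k t) a) ^+ 2 < r ^+ 2.
  by rewrite ltr_pXn2r// nnegrE ?edist_ge0// ltW.
rewrite edist_sqr /side/= (hexagon_vertex2 (ltnW k6)) hexagon_vertex2//.
set q := Num.sqrt 3; have q2 : q ^+ 2 = 3 by rewrite sqr_sqrtr.
have q0 : 0 < q by rewrite sqrtr_gt0.
set X := (_ - a.1); set Y := (_ - a.2 / q).
have -> : (1 - t) * (q * side_ordinate k) + t * (q * side_ordinate k.+1) - a.2 =
         q * Y.
  by rewrite /Y; field; rewrite gt_eqF.
rewrite exprMn q2 => lt2; rewrite -!ltr_norml.
have := sqr_ge0 X; have := sqr_ge0 Y => Y0 X0.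
split; rewrite -(@ltr_pXn2r _ 2)// ?nnegrE ?normr_ge0 ?(ltW r0)//
  real_normK ?num_real//; lra.
Qed.

Lemma meets_trimmed_side_inj r a j k : 0 < r -> (j < 6)%N -> (k < 6)%N ->
  meets_trimmed_side r a j -> meets_trimmed_side r a k -> j = k.
Proof.
move=> r0 j6 k6 /asboolP[s] /andP[s0 s1] /(side_coordinates_lt j6).
move=> [/andP[+ +] /andP[+ +]]
  /asboolP[t] /andP[t0 t1] /(side_coordinates_lt k6).
move=> + + + + [/andP[+ +] /andP[+ +]].
rewrite /hexagon_vertex /side_ordinate.
(* With the rescaled ordinate abstracted as [b], no square root is left, and each of the 30 pairs of
   distinct sides is refuted by rational linear arithmetic. *)
case: a => a1 a2 /=; move: (a2 / _) => b.
by move: j6 k6; do 6?[case: j => [|j]] => // _; do 6?[case: k => [|k]] => // _;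
  rewrite /=; move=> *; exfalso; lra.
Qed.

End sides.

(** * Lower bound for the distortion of a finite set *)

Section lower_bound.
Context (R : realType).
Variable alpha : {fset R * R}.
Implicit Types r : R.
Local Notation mu := (@lebesgue_measure R).

(** The test switches the bump of [a] off on all sides but at most one, so that over the whole
    hexagon each point is charged once. *)
Let side_bump r (k : nat) (a : R * R) : R -> \bar R :=
  if meets_trimmed_side r a k
  then bump r (foot (hexagon_vertex R k) (hexagon_vertex R k.+1) a)
  else cst 0%E.

Let side_bump_ge0 r k a t : (0 <= side_bump r k a t)%E.
Proof. by rewrite /side_bump; case: ifP => // _; exact: bump_ge0. Qed.

Let measurable_side_bump r k a : measurable_fun setT (side_bump r k a).
Proof. by rewrite /side_bump; case: ifP => // _; exact: measurable_bump. Qed.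

(** A point at distance at least [r] suffices by itself. A closer one meets the trimmed side, at
    [t], and its bump makes up the deficit because the foot is no farther from [t] than [a] is from
    [side k t]. *)
Let distortion_side_bump r k t : 0 < r -> (k < 6)%N ->
  4 * r <= t <= 1 - 4 * r ->
  ((r ^+ 2)%:E <=
   distortion alpha (side k t) + \sum_(a <- alpha) side_bump r k a t)%E.
Proof.
move=> r_gt0 k6 t_trim; apply: le_bigmine_sum => a; last exact: side_bump_ge0.
have [le_ra|lt_ar] := leP r (edist (side k t) a).
  apply: le_trans (leeDl _ (side_bump_ge0 _ _ _ _)).
  by rewrite lee_fin ler_pXn2r// nnegrE ?edist_ge0// ltW.
rewrite /side_bump ifT; last by apply/asboolP; exists t.
have := edist_sqr_foot a t (hexagon_side R k6); rewrite -/(side k t).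
set c := foot _ _ _ => le_tc.
have lt_d : (edist (side k t) a) ^+ 2 < r ^+ 2.
  by rewrite ltr_pXn2r// nnegrE ?edist_ge0// ltW.
rewrite bump_in; first by rewrite -EFinD lee_fin; lra.
rewrite -(@ler_pXn2r _ 2)// ?nnegrE ?(ltW r_gt0)// real_normK ?num_real//.
by apply: le_trans le_tc (ltW lt_d).
Qed.

(** Integrate the pointwise bound over the trimmed interval, of length 1 - 8 r, then enlarge to the
    full side by nonnegativity. The bump masses are added on the right, not subtracted on the left,
    since the distortion integral may be [+oo]. *)
Let side_lower_bound r k : 0 < r -> 8 * r < 1 -> (k < 6)%N ->
  ((r ^+ 2 * (1 - 8 * r))%:E <=
   \int[mu]_(t in `[0%R, 1%R]) distortion alpha (side k t) +
   (4 / 3 * r ^+ 3 *+ count (meets_trimmed_side r ^~ k) alpha)%:E)%E.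
Proof.
move=> r_gt0 r_lt k6; set D := `[0%R, 1%R]%classic.
have mD : measurable D by exact: measurable_itv.
have mdist : measurable_fun setT (fun t => distortion alpha (side k t)).
  exact: measurable_distortion_segment.
have msum : measurable_fun setT
    (fun t => \sum_(a <- alpha) side_bump r k a t)%E.
  by apply: emeasurable_sum => a; exact: measurable_side_bump.
apply: (@le_trans _ _ (\int[mu]_(t in D)
    (distortion alpha (side k t) + \sum_(a <- alpha) side_bump r k a t))%E).
  apply: (@le_trans _ _ (\int[mu]_(t in `[(4 * r)%R, (1 - 4 * r)%R])
    (cst (r ^+ 2)%:E t))%E).
    have lt_trim : 4 * r < 1 - 4 * r by lra.
    rewrite integral_cst//= lebesgue_measure_itv/= lte_fin lt_trim.
    by rewrite -EFinB -EFinM lee_fin; apply: ler_wpM2l; [exact: sqr_ge0|lra].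
  apply: (@le_trans _ _ (\int[mu]_(t in `[(4 * r)%R, (1 - 4 * r)%R])
    (distortion alpha (side k t) + \sum_(a <- alpha) side_bump r k a t))%E).
    apply: ge0_le_integral => //=.
    - by move=> t _; rewrite lee_fin sqr_ge0.
    - exact: measurable_funTS (emeasurable_funD mdist msum).
    - by move=> t; rewrite in_itv/=; exact: distortion_side_bump r_gt0 k6.
  apply: ge0_subset_integral => //.
  - exact: measurable_funTS (emeasurable_funD mdist msum).
  - move=> t _; apply: adde_ge0; first exact: distortion_ge0.
    by apply: sume_ge0 => a _.
  - by apply: subset_itv; rewrite bnd_simp; lra.
rewrite ge0_integralD//; last 4 first.
- by move=> t _; exact: distortion_ge0.
- exact: measurable_funTS.
- by move=> t _; apply: sume_ge0 => a _.
- exact: measurable_funTS.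
rewrite leeD2l// ge0_integral_sum//; last first.
  by move=> a; apply: measurable_funTS; exact: measurable_side_bump.
elim: (enum_fset alpha) => [|a s ih]; first by rewrite big_nil.
rewrite big_cons /= mulrnDr EFinD leeD//.
rewrite /side_bump; case: ifP => _; last by rewrite integral0.
by rewrite mulr1n; exact: integral_bump_le.
Qed.

(** Average of the six side bounds; 2/9 is 4/3 divided by the six sides. *)
Lemma hexagon_distortion_ge r : 0 < r -> 8 * r < 1 ->
  ((r ^+ 2 * (1 - 8 * r) - 2 / 9 * r ^+ 3 *+ #|` alpha|)%:E <=
   \int[@hexagon_uniform R]_x distortion alpha x)%E.
Proof.
move=> r_gt0 r_lt; rewrite integral_hexagon_distortion.
(* Double counting: each point meets at most one trimmed side. *)
have count_le :
    (\sum_(k < 6) count (meets_trimmed_side r ^~ k) alpha <= #|` alpha|)%N.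
  elim: (enum_fset alpha) => [|a s ih]; first by rewrite big1.
  rewrite /= big_split/= -[(size s).+1]add1n leq_add//.
  rewrite (eq_bigr
    (fun k : 'I_6 => if meets_trimmed_side r a k then 1 else 0)%N);
    last by move=> k _; case: meets_trimmed_side.
  rewrite -big_mkcond sum1_card; apply/card_le1_eqP => j k.
  rewrite !unfold_in => ja ka; apply: val_inj.
  exact: (meets_trimmed_side_inj r_gt0 _ _ ka ja).
set S := (\sum_(k < 6) _)%E.
have leS : (\sum_(k < 6) (r ^+ 2 * (1 - 8 * r))%:E <= S +
    \sum_(k < 6)
      (4 / 3 * r ^+ 3 *+ count (meets_trimmed_side r ^~ k) alpha)%:E)%E.
  by rewrite /S -big_split/=; apply: lee_sum => k _; exact: side_lower_bound.
move: leS; rewrite !sumEFin sumr_const card_ord sumrMnr.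
(* An infinite [S] makes the claim trivial, and [-oo] contradicts the lower bound. *)
move: S => [S||]; last 2 first.
- by move=> _; rewrite gt0_muley ?leey// lte_fin.
- by rewrite addNye leeNy_eq.
rewrite -EFinD -EFinM !lee_fin => leS.
have : 4 / 3 * r ^+ 3 *+ \sum_(k < 6) count (meets_trimmed_side r ^~ k) alpha <=
       4 / 3 * r ^+ 3 *+ #|` alpha|.
  by rewrite ler_wpMn2l// mulr_ge0// exprn_ge0// ltW.
move: leS; set N := (_ *+ (\sum_(k < 6) _)%N).
rewrite -2!(mulr_natr _ #|` alpha|) -(mulr_natr _ 6).
set M := (#|` alpha|)%:R; lra.
Qed.

End lower_bound.

(** * Upper bound from equally spaced midpoints *)

Section upper_bound.
Context (R : realType).
Variable m : nat.
Hypothesis m_gt0 : (0 < m)%N.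
Local Notation mu := (@lebesgue_measure R).

(** The midpoint of the piece from i/m to (i + 1)/m; [radius] is half the length of a piece. *)
Let center (i : nat) : R := (2 * i + 1)%:R / (2 * m)%:R.
Let radius : R := (2 * m)%:R^-1.

Let radius_gt0 : 0 < radius.
Proof. by rewrite invr_gt0 ltr0n muln_gt0. Qed.

Let cell (i : nat) : R -> \bar R :=
  (fun t => ((t - center i) ^+ 2)%:E) \_
  `[center i - radius, center i + radius].

Let cell_ge0 i t : (0 <= cell i t)%E.
Proof. by apply: erestrict_ge0 => s _; rewrite lee_fin sqr_ge0. Qed.

Let measurable_cell i : measurable_fun setT (cell i).
Proof.
apply/(measurable_restrictT _ _).1; first exact: measurable_itv.
apply/measurable_EFinP/measurable_funTS.
by apply: measurable_funX; apply: measurable_funB.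
Qed.

Let cell_cover t : 0 <= t <= 1 -> exists i : 'I_m, `|t - center i| <= radius.
Proof.
move=> /andP[t0 t1]; have m0 : 0 < m%:R :> R by rewrite ltr0n.
have tm0 : 0 <= t * m%:R by rewrite mulr_ge0.
have mE : (m.-1)%:R = m%:R - 1 :> R by rewrite -subn1 natrB.
suff [i /andP[i1 i2]] : exists i : 'I_m, i%:R <= t * m%:R <= i%:R + 1.
  exists i; rewrite /center /radius ler_distl natrD !natrM.
  rewrite -[t](@mulfK _ m%:R) ?gt_eqF//.
  rewrite !invfM; set im := m%:R^-1.
  have im0 : 0 < im by rewrite invr_gt0.
  have := ler_wpM2r (ltW im0) i1; have := ler_wpM2r (ltW im0) i2.
  lra.
have [tlt|tge] := ltP (t * m%:R) m%:R.
  have /andP[h1 h2] := truncn_itv tm0.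
  have im : (Num.truncn (t * m%:R) < m)%N.
    by rewrite -(ltr_nat R) (le_lt_trans h1).
  by exists (Ordinal im) => /=; rewrite h1 (le_trans (ltW h2))// natr1.
(* Here [t = 1], whose index by truncation would be [m], out of range; the last piece contains
   it. *)
have pm : (m.-1 < m)%N by rewrite prednK.
exists (Ordinal pm) => /=; rewrite mE.
have tm1 : t * m%:R <= m%:R by rewrite ler_piMl// ltW.
by apply/andP; split; [move: tge|move: tm1]; move: (m%:R) (t * _) => x y; lra.
Qed.

Let midpoints : {fset R * R} :=
  [fset x in [seq side k (center i) | k <- iota 0 6, i <- iota 0 m]]%fset.

Let card_midpoints : (#|` midpoints| <= 6 * m)%N.
Proof.
rewrite card_fseq (leq_trans (size_undup _))//.
by rewrite size_allpairs !size_iota.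
Qed.

(** Only a piece containing [t] matters. Endpoints shared by two pieces are counted twice in the
    sum, harmless for an upper bound. *)
Let distortion_midpoints k t : (k < 6)%N -> 0 <= t <= 1 ->
  (distortion midpoints (side k t) <= \sum_(i < m) cell i t)%E.
Proof.
move=> k6 t01; have [i ti] := cell_cover t01.
have mi : side k (center i) \in midpoints.
  rewrite in_fset; apply/allpairsP; exists (k, i : nat).
  by rewrite !mem_iota/= ltn_ord.
apply: le_trans (distortion_le _ mi) _.
rewrite edist_sqr_segment hexagon_side// expr1n mulr1.
rewrite (bigD1 i)//= /cell patchT; last first.
  by rewrite inE/= in_itv/= -ler_distlC distrC.
by rewrite leeDl//; apply: sume_ge0 => j _; exact: cell_ge0.
Qed.

(** Each of the [m] cells has integral (2/3) (1/(2m))^3 = 1/(12 m^3). *)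
Let side_distortion_midpoints k : (k < 6)%N ->
  (\int[mu]_(t in `[0%R, 1%R]) distortion midpoints (side k t) <=
   (m%:R^-2 / 12)%:E)%E.
Proof.
move=> k6; set D := `[0%R, 1%R]%classic.
have mD : measurable D by exact: measurable_itv.
apply: (@le_trans _ _ (\int[mu]_(t in D) (\sum_(i < m) cell i t))%E).
  apply: ge0_le_integral => //.
  - by move=> t _; exact: distortion_ge0.
  - exact: measurable_funTS (measurable_distortion_segment _ _ _).
  - apply: measurable_funTS; apply: emeasurable_sum => i.
    exact: measurable_cell.
  - by move=> t; rewrite /D/= in_itv/=; exact: distortion_midpoints.
rewrite ge0_integral_sum//; last first.
  by move=> i; apply: measurable_funTS; exact: measurable_cell.
apply: (@le_trans _ _ (\sum_(i < m) (2 / 3 * radius ^+ 3)%:E)%E).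
  apply: lee_sum => i _; apply: (@le_trans _ _ (\int[mu]_t cell i t)%E).
    by apply: ge0_subset_integral => //; exact: measurable_cell.
  rewrite -integral_mkcond.
  have -> : 2 / 3 * radius ^+ 3 =
            2 * 0 * radius + 2 / 3 * 1 * radius ^+ 3 by ring.
  rewrite -(integral_square (center i))//.
  by under eq_integral do rewrite -[X in X%:E]mul1r -[X in X%:E]add0r.
rewrite sumEFin sumr_const card_ord lee_fin /radius -mulr_natr natrM.
have m0 : m%:R != 0 :> R by rewrite pnatr_eq0 -lt0n.
by rewrite le_eqVlt; apply/orP; left; apply/eqP; field.
Qed.

Lemma hexagon_quantization_error_le n : (6 * m <= n)%N ->
  (quantization_error (@hexagon_uniform R) n <= (m%:R^-2 / 12)%:E)%E.
Proof.
move=> mn; apply: (@le_trans _ _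
  (\int[@hexagon_uniform R]_x distortion midpoints x)%E).
  apply: ereal_inf_lbound; exists midpoints => //=.
  exact: leq_trans card_midpoints mn.
rewrite integral_hexagon_distortion.
apply: (@le_trans _ _ ((6^-1)%:E * \sum_(k < 6) (m%:R^-2 / 12)%:E)%E).
  apply: lee_wpmul2l; first by rewrite lee_fin.
  apply: lee_sum => k _.
  exact: side_distortion_midpoints.
by rewrite sumEFin sumr_const card_ord -EFinM lee_fin -mulr_natr; lra.
Qed.

End upper_bound.

(** * From the coefficient to the dimension *)

Lemma cvg_ln_natr (R : realType) : (ln n%:R : R) @[n --> \oo] --> +oo.
Proof.
apply/cvgryPge => A; near=> n.
have An : expR A <= n%:R by near: n; exact: nbhs_infty_ger.
rewrite -(expRK A) ler_ln// ?posrE ?expR_gt0//.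
by apply: lt_le_trans An; exact: expR_gt0.
Unshelve. all: by end_near. Qed.

(** With a_n = n^(2/s) V_n, -ln V_n = (2/s) ln n - ln a_n, so the dimension quotient is the inverse
    of 1/s - ln a_n / (2 ln n). As [c > 0], ln a_n converges and the last term vanishes. *)
Lemma quantization_coefficient_dimension (R : realType)
    (P : probability (R * R)%type R) (s c : R) : 0 < s -> 0 < c ->
  has_quantization_coefficient s P c -> has_quantization_dimension P s.
Proof.
move=> s0 c0 /fine_cvgP[fin_a cvg_a].
rewrite /has_quantization_dimension.
set V := quantization_error P.
pose a (n : nat) : R := fine ((n%:R `^ (2 / s))%:E * V n)%E.
have cvg_lna : ln (a n) @[n --> \oo] --> ln c.
  exact: (continuous_cvg _ (continuous_ln c0) cvg_a).
have cvg_lnV : (ln n%:R : R)^-1 @[n --> \oo] --> 0.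
  apply/gtr0_cvgV0; last exact: cvg_ln_natr.
  near=> n; apply: ln_gt0; rewrite ltr1n; near: n; exact: nbhs_infty_gt.
suff : (s^-1 - ln (a n) / 2 * (ln n%:R)^-1)^-1 @[n --> \oo] --> s.
  apply: cvg_trans; apply: near_eq_cvg; near=> n.
  have n1 : (1 < n)%N by near: n; exact: nbhs_infty_gt.
  have n0 : 0 < n%:R :> R by rewrite ltr0n ltnW.
  have p0 : 0 < (n%:R : R) `^ (2 / s) by exact: powR_gt0.
  have lnn : ln n%:R != 0 :> R by rewrite gt_eqF// ln_gt0// ltr1n.
  have a0 : 0 < a n by near: n; exact: (cvgr_gt c cvg_a).
  have : ((n%:R `^ (2 / s))%:E * V n)%E \is a fin_num by near: n.
  move: a0; rewrite /a; case: (V n) => [v||].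
  - rewrite -EFinM /= => a0 _.
    have v0 : 0 < v by rewrite pmulr_rgt0 in a0.
    rewrite lnM ?posrE// ln_powR.
    rewrite -[RHS]invf_div; congr (_^-1).
    by field; rewrite lnn gt_eqF.
  - by move=> _; rewrite gt0_muley ?lte_fin.
  - by move=> _; rewrite gt0_muleNy ?lte_fin.
rewrite -[X in _ --> X]invrK; apply: cvgV; first by rewrite invr_eq0 gt_eqF.
rewrite -[X in _ --> X]subr0 -[X in _ - X](mulr0 (ln c / 2)).
apply: cvgB; first exact: cvg_cst.
by apply: cvgM => //; apply: cvgM => //; exact: cvg_cst.
Unshelve. all: by end_near. Qed.

(** * The quantization coefficient of the hexagon *)

Section hexagon_quantization_coefficient.
Context (R : realType).
Local Notation V := (quantization_error (@hexagon_uniform R)).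

(* The choice [r = 3 / n] maximizes the main term
   [r ^+ 2 - 2 / 9 * n * r ^+ 3]. *)
Let sqr_error_ge n : (24 < n)%N ->
  ((3 - 216 / n%:R)%:E <= (n%:R ^+ 2)%:E * V n)%E.
Proof.
move=> n24; have n0 : 24 < n%:R :> R by rewrite ltr_nat.
have n_gt0 : 0 < n%:R :> R by lra.
set r : R := 3 / n%:R.
have nr : n%:R * r = 3 by rewrite /r mulrC divfK ?gt_eqF.
have r0 : 0 < r by rewrite divr_gt0.
have r1 : 8 * r < 1 by rewrite /r mulrA ltr_pdivrMr// mul1r -natrM.
rewrite -lee_pdivrMl ?exprn_gt0// -EFinM.
apply: le_ereal_inf_tmp => _ [alpha /= card_alpha <-].
apply: le_trans (hexagon_distortion_ge alpha r0 r1).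
rewrite lee_fin.
have : 2 / 9 * r ^+ 3 *+ #|` alpha| <= 2 / 9 * r ^+ 3 *+ n.
  by rewrite ler_wpMn2l// mulr_ge0// exprn_ge0// ltW.
(* The main term is 9/n^2 - 6/n^2 = 3/n^2, and the trimming loss 8 r^3 is 216/n^3. *)
suff : (n%:R ^+ 2)^-1 * (3 - 216 / n%:R) =
    r ^+ 2 * (1 - 8 * r) - 2 / 9 * r ^+ 3 *+ n.
  lra.
by rewrite -mulr_natr /r; field; rewrite gt_eqF.
Qed.

(** With m = floor(n/6) and x = 12/n, n < 6m + 6 and n >= 12 give n/(6m) <= 1 + x. As x <= 1, 3 (1 +
    x)^2 <= 3 + 9 x = 3 + 108/n. *)
Let sqr_error_le n : (11 < n)%N ->
  ((n%:R ^+ 2)%:E * V n <= (3 + 108 / n%:R)%:E)%E.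
Proof.
move=> n12; have n0 : 12 <= n%:R :> R by rewrite ler_nat.
have n_gt0 : 0 < n%:R :> R by lra.
set m := (n %/ 6)%N.
have m0 : (0 < m)%N by rewrite divn_gt0// (leq_trans _ n12).
have mn : (6 * m <= n)%N by rewrite mulnC leq_trunc_div.
rewrite -lee_pdivlMl ?exprn_gt0//.
apply: le_trans (hexagon_quantization_error_le R m0 mn) _.
rewrite -EFinM lee_fin.
have nm : n%:R < 6 * m%:R + 6 :> R.
  by rewrite -natrM -natrD ltr_nat mulnC addnC -mulSn ltn_ceil.
have m_ge1 : 1 <= m%:R :> R by rewrite ler1n.
have m_gt0 : 0 < m%:R :> R by lra.
rewrite ler_pdivlMl ?exprn_gt0//.
have -> : n%:R ^+ 2 * (m%:R ^- 2 / 12) = 3 * (n%:R / (6 * m%:R)) ^+ 2 :> R.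
  by field; rewrite gt_eqF.
set x : R := 12 / n%:R.
have nx : n%:R * x = 12 by rewrite /x mulrC divfK ?gt_eqF.
have x0 : 0 < x by rewrite divr_gt0.
have x1 : x <= 1 by rewrite /x ler_pdivrMr// mul1r.
have -> : 3 + 108 / n%:R = 3 + 9 * x by rewrite /x; field; rewrite gt_eqF.
have : n%:R / (6 * m%:R) <= 1 + x.
  by rewrite ler_pdivrMr ?mulr_gt0//; nra.
have : 0 <= n%:R / (6 * m%:R) :> R by rewrite divr_ge0// ltW// mulr_gt0.
set y := n%:R / _ => y0 yx; nra.
Qed.

Lemma hexagon_quantization_coefficient :
  has_quantization_coefficient 1 (@hexagon_uniform R) 3.
Proof.
rewrite /has_quantization_coefficient.
have cvg_inv (b : R) : (3 + b / n%:R)%:E @[n --> \oo] --> 3%:E.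
  apply: cvg_EFin; first exact: nearW.
  rewrite -[X in _ --> X]addr0 -[X in _ + X](mulr0 b).
  apply: cvgD; first exact: cvg_cst.
  apply: cvgM; first exact: cvg_cst.
  apply/gtr0_cvgV0; last exact: cvgr_idn.
  by near=> n; rewrite ltr0n; near: n; exact: nbhs_infty_gt.
apply: (@squeeze_cvge _ _ _ _ (fun n : nat => (3 + (- 216) / n%:R)%:E) _
  (fun n : nat => (3 + 108 / n%:R)%:E)) => //.
near=> n; rewrite divr1 powR_mulrn ?ler0n//.
rewrite mulNr sqr_error_ge ?sqr_error_le//.
- by near: n; exact: nbhs_infty_gt.
- by near: n; exact: nbhs_infty_gt.
Unshelve. all: by end_near. Qed.

End hexagon_quantization_coefficient.

Theorem proposition3p11 (R : realType) :
  has_quantization_dimension (@hexagon_uniform R) 1 /\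
  has_quantization_coefficient 1 (@hexagon_uniform R) 3.
Proof.
have coef := @hexagon_quantization_coefficient R.
by split=> //; exact: quantization_coefficient_dimension coef.
Qed.
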